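(* If $\mathcal{B}$ is a full subcategory of an algebraically coherent category $\mathcal{C}$ closed under finite products and subobjects (and hence all finite limits), then $\mathcal{B}$ is algebraically coherent. In particular, any (regular epi)-reflective subcategory of an algebraically coherent category is algebraically coherent.
   Context: A (regular epi)-reflective subcategory is a full reflective subcategory such that every component of the unit of the reflection is a regular epimorphism. A cospan $(f\colon X\to Z,\ g\colon Y\to Z)$ in a category with finite limits is jointly strongly epimorphic if every monomorphism into $Z$ through which both $f$ and $g$ factor is an isomorphism. A functor between categories with finite limits is coherent if it preserves finite limits and jointly strongly epimorphic pairs. $\mathsf{Pt}_X(\mathcal{C})$ is the category of points over $X$: objects are triples $(A,\ p\colon A\to X,\ s\colon X\to A)$ with $ps=1_X$, and morphisms are morphisms between the objects $A$ commuting with the $p$'s and the $s$'s. For $f\colon X\to Y$, the change-of-base functor $f^*\colon \mathsf{Pt}_Y(\mathcal{C})\to\mathsf{Pt}_X(\mathcal{C})$ is pulling back along $f$. A category $\mathcal{C}$ with finite limits is algebraically coherent if $f^*$ is coherent for every morphism $f$ of $\mathcal{C}$. *)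

(* Defs.v *)
From Stdlib Require Import List FinFun ClassicalEpsilon.

Set Implicit Arguments.
Unset Strict Implicit.
Unset Printing Implicit Defensive.

Declare Scope cat_scope.
Delimit Scope cat_scope with cat.
Local Open Scope cat_scope.

Record category := Category {
  ob :> Type;
  hom : ob -> ob -> Type;
  idm : forall x, hom x x;
  comp : forall x y z, hom y z -> hom x y -> hom x z;
  comp_id_l : forall x y (f : hom x y), comp (idm y) f = f;
  comp_id_r : forall x y (f : hom x y), comp f (idm x) = f;
  comp_assoc : forall w x y z (h : hom y z) (g : hom x y) (f : hom w x),
    comp h (comp g f) = comp (comp h g) f
}.

Arguments hom {c} x y.
Arguments idm {c} x.
Arguments comp {c x y z} g f.

Notation "g ∘ f" := (comp g f) (at level 40, left associativity) : cat_scope.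

Record functor (C D : category) := Functor {
  fob :> C -> D;
  fmap : forall x y, hom x y -> hom (fob x) (fob y);
  fmap_id : forall x, fmap (idm x) = idm (fob x);
  fmap_comp : forall x y z (g : hom y z) (f : hom x y),
    fmap (g ∘ f) = fmap g ∘ fmap f
}.

Arguments fmap {C D} f {x y} h : rename.

Definition functor_comp (C D E : category) (G : functor D E) (F : functor C D) :
  functor C E.
Proof.
refine (@Functor C E (fun x => G (F x)) (fun x y h => fmap G (fmap F h)) _ _).
- intros x; rewrite !fmap_id; reflexivity.
- intros x y z g f; rewrite !fmap_comp; reflexivity.
Defined.

Record adjunction (C D : category) (F : functor C D) (G : functor D C) :=
  Adjunction {
  adj_unit : forall x : C, hom x (G (F x));
  adj_counit : forall y : D, hom (F (G y)) y;
  adj_unit_natural : forall (x x' : C) (h : hom x x'),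
    adj_unit x' ∘ h = fmap G (fmap F h) ∘ adj_unit x;
  adj_counit_natural : forall (y y' : D) (h : hom y y'),
    adj_counit y' ∘ fmap F (fmap G h) = h ∘ adj_counit y;
  adj_triangle_l : forall x : C, adj_counit (F x) ∘ fmap F (adj_unit x) = idm (F x);
  adj_triangle_r : forall y : D, fmap G (adj_counit y) ∘ adj_unit (G y) = idm (G y)
}.

Section Morphisms.

Variable C : category.

Definition is_mono (x y : C) (m : hom x y) : Prop :=
  forall (t : C) (u v : hom t x), m ∘ u = m ∘ v -> u = v.

Definition is_iso (x y : C) (f : hom x y) : Prop :=
  exists g : hom y x, g ∘ f = idm x /\ f ∘ g = idm y.

Definition factors_through (x z s : C) (f : hom x z) (m : hom s z) : Prop :=
  exists f' : hom x s, m ∘ f' = f.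

Definition jointly_strongly_epi (x y z : C) (f : hom x z) (g : hom y z) : Prop :=
  forall (s : C) (m : hom s z),
    is_mono m -> factors_through f m -> factors_through g m -> is_iso m.

Definition is_coequalizer (w x y : C) (u v : hom w x) (e : hom x y) : Prop :=
  e ∘ u = e ∘ v /\
  forall (t : C) (h : hom x t), h ∘ u = h ∘ v -> exists! k : hom y t, k ∘ e = h.

Definition is_regular_epi (x y : C) (e : hom x y) : Prop :=
  exists (w : C) (u v : hom w x), is_coequalizer u v e.

Definition is_product (I : Type) (A : I -> C) (P : C) (pr : forall i, hom P (A i)) :
    Prop :=
  forall (t : C) (h : forall i, hom t (A i)),
    exists! k : hom t P, forall i, pr i ∘ k = h i.

End Morphisms.

Record cone (J C : category) (D : functor J C) := Cone {
  apex : C;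
  leg : forall j : J, hom apex (D j);
  leg_compat : forall (i j : J) (a : hom i j), fmap D a ∘ leg i = leg j
}.

Arguments leg {J C D} c j.

Definition is_limit (J C : category) (D : functor J C) (c : cone D) : Prop :=
  forall c' : cone D,
    exists! h : hom (apex c') (apex c), forall j, leg c j ∘ h = leg c' j.

Definition map_cone (J C E : category) (F : functor C E) (D : functor J C)
    (c : cone D) : cone (functor_comp F D).
Proof.
refine (@Cone J E (functor_comp F D) (F (apex c)) (fun j => fmap F (leg c j)) _).
intros i j a; simpl; rewrite <- fmap_comp, leg_compat; reflexivity.
Defined.

Definition finite_category (J : category) : Prop :=
  Finite (ob J) /\ forall i j : J, Finite (hom i j).

Definition has_finite_limits (C : category) : Prop :=
  forall J : category, finite_category J ->
  forall D : functor J C, exists c : cone D, is_limit c.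

Definition preserves_finite_limits (C E : category) (F : functor C E) : Prop :=
  forall J : category, finite_category J ->
  forall (D : functor J C) (c : cone D), is_limit c -> is_limit (map_cone F c).

Definition coherent (C E : category) (F : functor C E) : Prop :=
  preserves_finite_limits F /\
  forall (x y z : C) (f : hom x z) (g : hom y z),
    jointly_strongly_epi f g -> jointly_strongly_epi (fmap F f) (fmap F g).

Section Points.

Variables (C : category) (X : C).

Record point := Point {
  pt_ob : C;
  pt_proj : hom pt_ob X;
  pt_sect : hom X pt_ob;
  pt_split : pt_proj ∘ pt_sect = idm X
}.

Record point_hom (a b : point) := PointHom {
  pt_mor : hom (pt_ob a) (pt_ob b);
  pt_mor_proj : pt_proj b ∘ pt_mor = pt_proj a;
  pt_mor_sect : pt_mor ∘ pt_sect a = pt_sect b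
}.

Lemma point_hom_eq (a b : point) (h k : point_hom a b) :
  pt_mor h = pt_mor k -> h = k.
Proof.
destruct h as [h p q], k as [k p' q']; simpl; intros e; destruct e.
rewrite (proof_irrelevance _ p' p), (proof_irrelevance _ q' q); reflexivity.
Qed.

Definition point_id (a : point) : point_hom a a :=
  @PointHom a a (idm (pt_ob a)) (comp_id_r _) (comp_id_l _).

Definition point_comp (a b c : point) (g : point_hom b c) (f : point_hom a b) :
  point_hom a c.
Proof.
refine (@PointHom a c (pt_mor g ∘ pt_mor f) _ _).
- rewrite comp_assoc, !pt_mor_proj; reflexivity.
- rewrite <- comp_assoc, !pt_mor_sect; reflexivity.
Defined.

Definition Pt : category.
Proof.
refine (@Category point point_hom point_id point_comp _ _ _);
  intros; apply point_hom_eq; simpl.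
- apply comp_id_l.
- apply comp_id_r.
- apply comp_assoc.
Defined.

End Points.

Arguments Pt {C} X.

Record pullback (C : category) (A X Y : C) (p : hom A Y) (f : hom X Y) := Pullback {
  pb_ob : C;
  pb_fst : hom pb_ob A;
  pb_snd : hom pb_ob X;
  pb_comm : p ∘ pb_fst = f ∘ pb_snd;
  pb_pair : forall (t : C) (a : hom t A) (x : hom t X), p ∘ a = f ∘ x -> hom t pb_ob;
  pb_pair_fst : forall (t : C) (a : hom t A) (x : hom t X) (e : p ∘ a = f ∘ x),
    pb_fst ∘ pb_pair e = a;
  pb_pair_snd : forall (t : C) (a : hom t A) (x : hom t X) (e : p ∘ a = f ∘ x),
    pb_snd ∘ pb_pair e = x;
  pb_ext : forall (t : C) (u v : hom t pb_ob),
    pb_fst ∘ u = pb_fst ∘ v -> pb_snd ∘ u = pb_snd ∘ v -> u = v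
}.

Arguments pb_ob {C A X Y p f} p0 : rename.
Arguments pb_fst {C A X Y p f} p0 : rename.
Arguments pb_snd {C A X Y p f} p0 : rename.
Arguments pb_comm {C A X Y p f} p0 : rename.
Arguments pb_pair {C A X Y p f} p0 {t a x} _ : rename.
Arguments pb_ext {C A X Y p f} p0 {t u v} _ _ : rename.

Definition pullbacks_along (C : category) (X Y : C) (f : hom X Y) : Type :=
  forall (A : C) (p : hom A Y), pullback p f.

Section ChangeOfBase.

Variables (C : category) (X Y : C) (f : hom X Y) (pb : pullbacks_along f).

Lemma base_change_sect_comm (a : point Y) :
  pt_proj a ∘ (pt_sect a ∘ f) = f ∘ idm X.
Proof. rewrite comp_assoc, pt_split, comp_id_l, comp_id_r; reflexivity. Qed.

Definition base_change_ob (a : point Y) : point X :=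
  @Point C X (pb_ob (pb (pt_proj a))) (pb_snd (pb (pt_proj a)))
    (pb_pair (pb (pt_proj a)) (base_change_sect_comm a))
    (pb_pair_snd _ (base_change_sect_comm a)).

Lemma base_change_hom_comm (a b : point Y) (h : point_hom a b) :
  pt_proj b ∘ (pt_mor h ∘ pb_fst (pb (pt_proj a))) = f ∘ pb_snd (pb (pt_proj a)).
Proof. rewrite comp_assoc, pt_mor_proj; apply pb_comm. Qed.

Definition base_change_hom (a b : point Y) (h : point_hom a b) :
  point_hom (base_change_ob a) (base_change_ob b).
Proof.
refine (@PointHom C X (base_change_ob a) (base_change_ob b)
          (pb_pair (pb (pt_proj b)) (base_change_hom_comm h)) _ _).
- apply pb_pair_snd.
- apply pb_ext; simpl.
  + rewrite comp_assoc, !pb_pair_fst, <- comp_assoc, pb_pair_fst, comp_assoc, pt_mor_sect.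
    reflexivity.
  + rewrite comp_assoc, !pb_pair_snd; reflexivity.
Defined.

Definition change_of_base : functor (Pt Y) (Pt X).
Proof.
refine (@Functor (Pt Y) (Pt X) base_change_ob base_change_hom _ _).
- intros a; apply point_hom_eq; simpl; apply pb_ext.
  + rewrite pb_pair_fst, comp_id_r; apply comp_id_l.
  + rewrite pb_pair_snd, comp_id_r; reflexivity.
- intros a b c g h; apply point_hom_eq; simpl; apply pb_ext.
  + rewrite pb_pair_fst, (comp_assoc (pb_fst _)), pb_pair_fst.
    rewrite <- !comp_assoc, pb_pair_fst; reflexivity.
  + rewrite pb_pair_snd, comp_assoc, !pb_pair_snd; reflexivity.
Defined.

End ChangeOfBase.

(* The functor f^* depends on a choice of pullbacks along f; any two choices give
   isomorphic functors.  The definition ranges over all choices, and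
   [pullbacks_along_inhabited] below shows that there always is one. *)
Definition algebraically_coherent (C : category) : Prop :=
  has_finite_limits C /\
  forall (X Y : C) (f : hom X Y) (pb : pullbacks_along f),
    coherent (change_of_base pb).

Section PullbacksExist.

Inductive cospan_ob := cs_left | cs_right | cs_base.

Definition cospan_hom (i j : cospan_ob) : Type :=
  match i, j with
  | cs_left, cs_left | cs_right, cs_right | cs_base, cs_base
  | cs_left, cs_base | cs_right, cs_base => unit
  | _, _ => Empty_set
  end.

Definition cospan : category.
Proof.
refine (@Category cospan_ob cospan_hom
  (fun i => match i with cs_left | cs_right | cs_base => tt end)
  (fun i j k => match i, j, k with
     | cs_left, cs_left, cs_left | cs_right, cs_right, cs_right
     | cs_base, cs_base, cs_base | cs_left, cs_left, cs_base
     | cs_right, cs_right, cs_base | cs_left, cs_base, cs_base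
     | cs_right, cs_base, cs_base => fun _ _ => tt
     | cs_left, cs_right, _ | cs_right, cs_left, _
     | cs_base, cs_left, _ | cs_base, cs_right, _ => fun _ f => match f with end
     | _, _, _ => fun g _ => match g with end
     end) _ _ _).
- intros [] [] []; reflexivity.
- intros [] [] []; reflexivity.
- intros [] [] [] [] [] [] []; reflexivity.
Defined.

Lemma cospan_finite : finite_category cospan.
Proof.
split.
- exists (cs_left :: cs_right :: cs_base :: nil); intros []; simpl; tauto.
- intros [] []; simpl;
    ((exists (tt :: nil); intros []; simpl; tauto) || (exists nil; intros [])).
Qed.

Variables (C : category) (A X Y : C) (p : hom A Y) (f : hom X Y).

Definition cospan_functor_ob (i : cospan_ob) : C :=
  match i with cs_left => A | cs_right => X | cs_base => Y end.

Definition cospan_functor : functor cospan C.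
Proof.
refine (@Functor cospan C cospan_functor_ob
  (fun i j => match i, j return @hom cospan i j ->
        hom (cospan_functor_ob i) (cospan_functor_ob j) with
     | cs_left, cs_left | cs_right, cs_right | cs_base, cs_base => fun _ => idm _
     | cs_left, cs_base => fun _ => p
     | cs_right, cs_base => fun _ => f
     | _, _ => fun a => match a with end
     end) _ _).
- intros []; reflexivity.
- intros [] [] [] [] []; simpl; rewrite ?comp_id_l, ?comp_id_r; reflexivity.
Defined.

Definition cospan_cone (t : C) (a : hom t A) (x : hom t X) (e : p ∘ a = f ∘ x) :
  cone cospan_functor.
Proof.
refine (@Cone cospan C cospan_functor t
  (fun j => match j with cs_left => a | cs_right => x | cs_base => f ∘ x end) _).
intros [] [] []; simpl; rewrite ?comp_id_l; auto.
Defined.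

Lemma pullback_inhabited : has_finite_limits C -> inhabited (pullback p f).
Proof.
intros HC; destruct (HC cospan cospan_finite cospan_functor) as [c Hc].
pose (l := leg c cs_left : hom (apex c) A).
pose (r := leg c cs_right : hom (apex c) X).
pose (d := leg c cs_base : hom (apex c) Y).
assert (cl : p ∘ l = d) by exact (@leg_compat _ _ _ c cs_left cs_base tt).
assert (cr : f ∘ r = d) by exact (@leg_compat _ _ _ c cs_right cs_base tt).
pose (med := fun t a x (e : p ∘ a = f ∘ x) =>
  constructive_indefinite_description _ (Hc (@cospan_cone t a x e))).
constructor.
refine (@Pullback C A X Y p f (apex c) l r _
  (fun t a x e => proj1_sig (med t a x e)) _ _ _).
- rewrite cl, cr; reflexivity.
- intros t a x e; exact (proj1 (proj2_sig (med t a x e)) cs_left).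
- intros t a x e; exact (proj1 (proj2_sig (med t a x e)) cs_right).
- intros t u v el er.
  assert (e : p ∘ (l ∘ v) = f ∘ (r ∘ v))
    by (rewrite !comp_assoc, cl, cr; reflexivity).
  destruct (Hc (cospan_cone e)) as [w [_ Hw]].
  transitivity w; [symmetry|]; apply Hw; intros [].
  + exact el.
  + exact er.
  + change (d ∘ u = f ∘ (r ∘ v)); rewrite <- er, comp_assoc, cr; reflexivity.
  + reflexivity.
  + reflexivity.
  + change (d ∘ v = f ∘ (r ∘ v)); rewrite comp_assoc, cr; reflexivity.
Qed.

End PullbacksExist.

Lemma pullbacks_along_inhabited (C : category) (X Y : C) (f : hom X Y) :
  has_finite_limits C -> inhabited (pullbacks_along f).
Proof.
intros HC; constructor; intros A p.
destruct (constructive_indefinite_description (fun _ : pullback p f => True)) as [q _].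
- destruct (pullback_inhabited p f HC) as [q]; exists q; exact I.
- exact q.
Qed.

Section FullSubcategory.

Variables (C : category) (B : C -> Prop).

Definition full_subcategory : category :=
  @Category {x : C | B x} (fun x y => hom (proj1_sig x) (proj1_sig y))
    (fun x => idm (proj1_sig x)) (fun x y z g f => g ∘ f)
    (fun x y f => comp_id_l f) (fun x y f => comp_id_r f)
    (fun w x y z h g f => comp_assoc h g f).

Definition inclusion : functor full_subcategory C :=
  @Functor full_subcategory C (fun x => proj1_sig x) (fun x y f => f)
    (fun x => eq_refl) (fun x y z g f => eq_refl).

(* The index type may be empty, so a terminal object of C must lie in B. *)
Definition closed_under_finite_products : Prop :=
  forall I : Type, Finite I ->
  forall (A : I -> C) (P : C) (pr : forall i, hom P (A i)),
    is_product pr -> (forall i, B (A i)) -> B P.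

Definition closed_under_subobjects : Prop :=
  forall (s x : C) (m : hom s x), is_mono m -> B x -> B s.

Definition closed_under_finite_limits : Prop :=
  forall J : category, finite_category J ->
  forall (D : functor J C) (c : cone D),
    is_limit c -> (forall j, B (D j)) -> B (apex c).

(* B is not assumed to be closed under isomorphism in C. *)
Definition regular_epi_reflective : Prop :=
  exists (R : functor C full_subcategory) (adj : adjunction R inclusion),
    forall x : C, is_regular_epi (adj_unit adj x).

End FullSubcategory.

(* Main.v *)
Require Import Defs.
From Stdlib Require Import List FinFun ClassicalEpsilon.

Set Implicit Arguments.
Unset Strict Implicit.
Unset Printing Implicit Defensive.

Local Open Scope cat_scope.

(** The statement is a comparison between [B] and [C]: everything that enters
    the definition of algebraic coherence is the same computed in either
    category.

    Joint strong epimorphicity of a cospan of points does not see the point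
    structure.  If [f] and [g] are morphisms of points over [Y] and both factor
    through a subobject [m] of the underlying object of their codomain [c], then
    the section of [c] factors through [m] as well, because [f] carries the
    section of its domain to that of [c]; so [m] is a subobject of points.  Hence
    coherence of [f^*] on cospans says that jointly strongly epimorphic pairs of
    underlying morphisms stay so after pulling back
    ([point_jointly_strongly_epi], [underlying_jointly_strongly_epi],
    [pullback_jointly_strongly_epi]).

    The other half of coherence is automatic: [f^*] preserves finite limits
    whenever the category has finite limits
    ([change_of_base_preserves_finite_limits]).

    Now suppose that the objects isomorphic to one in [B] are closed under finite
    products and subobjects.  A finite limit is a subobject of a finite product, so
    finite limits of diagrams in [B] may be computed in [C].  In particular
    pullbacks and monomorphisms agree; and every subobject in [C] of an object of
    [B] is isomorphic to one in [B], so jointly strongly epimorphic pairs agree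
    too ([inclusion_jointly_strongly_epi]).  A jointly strongly epimorphic pair of
    points in [B] can then be moved to [C], pulled back there, and moved back:
    this is [full_subcategory_algebraically_coherent].

    Both parts of the theorem are instances.  In the reflective case [B] itself
    need not be closed under isomorphism, which is why the hypotheses are put on
    the replete closure; the latter consists of the objects whose unit is
    invertible.  A regular epimorphism that is monic is invertible, so it suffices
    that the unit be monic at a finite product or at a subobject of such objects,
    which naturality gives. *)

(** * Isomorphisms, pullbacks and jointly strongly epimorphic pairs *)

Section Basics.

Variable C : category.

Lemma is_iso_id (x : C) : is_iso (idm x).
Proof. exists (idm x); split; apply comp_id_l. Qed.

Lemma is_iso_comp (x y z : C) (g : hom y z) (f : hom x y) :
  is_iso g -> is_iso f -> is_iso (g ∘ f).
Proof.
intros [g' [g1 g2]] [f' [f1 f2]]; exists (f' ∘ g'); split.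
- rewrite <- (comp_assoc f'), (comp_assoc g'), g1, comp_id_l; exact f1.
- rewrite <- (comp_assoc g), (comp_assoc f), f2, comp_id_l; exact g2.
Qed.

Lemma is_iso_mono (x y : C) (f : hom x y) : is_iso f -> is_mono f.
Proof.
intros [f' [f1 _]] t u v e.
rewrite <- (comp_id_l u), <- (comp_id_l v), <- f1, <- !comp_assoc, e; reflexivity.
Qed.

Lemma is_mono_comp (x y z : C) (g : hom y z) (f : hom x y) :
  is_mono g -> is_mono f -> is_mono (g ∘ f).
Proof.
intros Hg Hf t u v e; apply Hf, Hg; rewrite !comp_assoc; exact e.
Qed.

Lemma is_mono_of_comp (x y z : C) (g : hom y z) (f : hom x y) :
  is_mono (g ∘ f) -> is_mono f.
Proof. intros H t u v e; apply H; rewrite <- !comp_assoc, e; reflexivity. Qed.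

Lemma is_iso_of_comp (x y z : C) (g : hom y z) (f : hom x y) :
  is_iso g -> is_iso (g ∘ f) -> is_iso f.
Proof.
intros [g' [g1 g2]] Hgf.
replace f with (g' ∘ (g ∘ f)) by (rewrite comp_assoc, g1; apply comp_id_l).
apply is_iso_comp; [exists g; split|]; assumption.
Qed.

Lemma is_iso_of_comp_r (x y z : C) (g : hom y z) (f : hom x y) :
  is_iso f -> is_iso (g ∘ f) -> is_iso g.
Proof.
intros [f' [f1 f2]] Hgf.
replace g with (g ∘ f ∘ f') by (rewrite <- comp_assoc, f2; apply comp_id_r).
apply is_iso_comp; [|exists f; split]; assumption.
Qed.

Lemma regular_epi_cancel (x y t : C) (e : hom x y) (h k : hom y t) :
  is_regular_epi e -> h ∘ e = k ∘ e -> h = k.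
Proof.
intros (w & u & v & euv & H) hk.
destruct (H t (k ∘ e)) as [l [_ Hl]].
- rewrite <- !comp_assoc, euv; reflexivity.
- transitivity l; [symmetry|]; apply Hl; auto.
Qed.

Lemma regular_epi_mono_iso (x y : C) (e : hom x y) :
  is_regular_epi e -> is_mono e -> is_iso e.
Proof.
intros He Hm; pose proof He as (w & u & v & euv & H).
destruct (H x (idm x)) as [k [ke _]].
- rewrite !comp_id_l; apply Hm, euv.
- exists k; split; [exact ke|].
  apply (regular_epi_cancel He).
  rewrite <- comp_assoc, ke, comp_id_r, comp_id_l; reflexivity.
Qed.

(** The maps [a] and [b] between the domains are arbitrary: precomposing only
    makes it easier to factor through a subobject.  Invertibility of [k] is what
    lets a subobject of [z'] be viewed as one of [z]. *)
Lemma jointly_strongly_epi_transfer (x y z x' y' z' : C)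
    (f : hom x z) (g : hom y z) (f' : hom x' z') (g' : hom y' z')
    (a : hom x x') (b : hom y y') (k : hom z z') :
  is_iso k -> f' ∘ a = k ∘ f -> g' ∘ b = k ∘ g ->
  jointly_strongly_epi f g -> jointly_strongly_epi f' g'.
Proof.
intros [k' [k1 k2]] ef eg H s m Hm [f1 ef1] [g1 eg1].
apply (@is_iso_of_comp _ _ _ k' m); [exists k; split; assumption|].
apply H.
- apply is_mono_comp; [apply is_iso_mono; exists k; split|]; assumption.
- exists (f1 ∘ a).
  rewrite <- comp_assoc, (comp_assoc m), ef1, ef, comp_assoc, k1; apply comp_id_l.
- exists (g1 ∘ b).
  rewrite <- comp_assoc, (comp_assoc m), eg1, eg, comp_assoc, k1; apply comp_id_l.
Qed.

(** Pullback squares as a property, so that squares living in [C] and in a full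
    subcategory, or coming from different choices, can be compared. *)
Definition is_pullback (A X Y P : C) (p : hom A Y) (f : hom X Y)
    (u : hom P A) (v : hom P X) : Prop :=
  p ∘ u = f ∘ v /\
  forall (t : C) (a : hom t A) (x : hom t X), p ∘ a = f ∘ x ->
    exists! w : hom t P, u ∘ w = a /\ v ∘ w = x.

Lemma pullback_is_pullback (A X Y : C) (p : hom A Y) (f : hom X Y)
    (q : pullback p f) : is_pullback p f (pb_fst q) (pb_snd q).
Proof.
split; [apply pb_comm|]; intros t a x e.
exists (pb_pair q e); split.
- split; [apply pb_pair_fst|apply pb_pair_snd].
- intros w [wa wx]; apply (pb_ext q).
  + rewrite pb_pair_fst; auto.
  + rewrite pb_pair_snd; auto.
Qed.

Lemma is_pullback_ext (A X Y P : C) (p : hom A Y) (f : hom X Y)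
    (u : hom P A) (v : hom P X) (t : C) (w w' : hom t P) :
  is_pullback p f u v -> u ∘ w = u ∘ w' -> v ∘ w = v ∘ w' -> w = w'.
Proof.
intros [e H] eu ev.
destruct (H t (u ∘ w') (v ∘ w')) as [w0 [_ Hw]].
- rewrite !comp_assoc, e; reflexivity.
- transitivity w0; [symmetry|]; apply Hw; auto.
Qed.

Lemma is_pullback_unique (A X Y P Q : C) (p : hom A Y) (f : hom X Y)
    (u : hom P A) (v : hom P X) (u' : hom Q A) (v' : hom Q X) :
  is_pullback p f u v -> is_pullback p f u' v' ->
  exists k : hom P Q, is_iso k /\ u' ∘ k = u /\ v' ∘ k = v.
Proof.
intros HP HQ.
destruct (proj2 HQ P u v (proj1 HP)) as [k [[k1 k2] _]].
destruct (proj2 HP Q u' v' (proj1 HQ)) as [k' [[k1' k2'] _]].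
exists k; split; [|split; assumption].
exists k'; split.
- apply (is_pullback_ext HP); rewrite comp_assoc, comp_id_r; congruence.
- apply (is_pullback_ext HQ); rewrite comp_assoc, comp_id_r; congruence.
Qed.

Lemma limit_ext (J : category) (D : functor J C) (c : cone D) (t : C)
    (u v : hom t (apex c)) :
  is_limit c -> (forall j, leg c j ∘ u = leg c j ∘ v) -> u = v.
Proof.
intros Hc e.
unshelve epose (c' := @Cone J C D t (fun j => leg c j ∘ v) _).
{ intros i j a; cbn beta; rewrite comp_assoc, leg_compat; reflexivity. }
destruct (Hc c') as [w [_ Hw]].
transitivity w; [symmetry|]; apply Hw; simpl; auto.
Qed.

End Basics.

(** * Closure under finite limits *)

Section Products.

Definition discrete (I : Type) : category.
Proof.
refine (@Category I (fun i j => i = j) (fun i => eq_refl)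
  (fun i j k e e' => eq_trans e' e) _ _ _); intros; apply proof_irrelevance.
Defined.

Lemma discrete_finite (I : Type) : Finite I -> finite_category (discrete I).
Proof.
intros HI; split; [exact HI|]; intros i j; simpl.
destruct (classic (i = j)) as [e|n].
- exists (e :: nil); intros e'; left; apply proof_irrelevance.
- exists nil; intros e; exact (n e).
Qed.

Definition discrete_functor (C : category) (I : Type) (A : I -> C) :
  functor (discrete I) C.
Proof.
refine (@Functor (discrete I) C A
  (fun i j e => match e in _ = j return hom (A i) (A j) with
                | eq_refl => idm _ end) _ _).
- reflexivity.
- intros i j k e e'; destruct e'; destruct e; simpl; rewrite comp_id_l; reflexivity.
Defined.

Variable C : category.

Lemma finite_product_exists (I : Type) (A : I -> C) :
  has_finite_limits C -> Finite I ->
  exists (P : C) (pr : forall i, hom P (A i)), is_product pr.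
Proof.
intros HC HI.
destruct (HC _ (discrete_finite HI) (discrete_functor A)) as [c Hc].
exists (apex c), (leg c); intros t h.
unshelve epose (c' := @Cone _ C (discrete_functor A) t h _).
{ intros i j e; destruct e; simpl; apply comp_id_l. }
exact (Hc c').
Qed.

Variable B : C -> Prop.

(** A finite jointly monic family out of [s] exhibits [s] as a subobject of a
    finite product.  Limit cones and pullback projections are such families. *)
Lemma closed_under_jointly_monic (I : Type) (A : I -> C) (s : C)
    (l : forall i, hom s (A i)) :
  has_finite_limits C ->
  closed_under_finite_products B -> closed_under_subobjects B -> Finite I ->
  (forall (t : C) (u v : hom t s), (forall i, l i ∘ u = l i ∘ v) -> u = v) ->
  (forall i, B (A i)) -> B s.
Proof.
intros HC Hp Hs HI Hl HA.
destruct (finite_product_exists A HC HI) as (P & pr & HP).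
destruct (HP s l) as [m [em _]].
apply (Hs s P m).
- intros t u v e; apply Hl; intros i.
  rewrite <- (em i), <- !comp_assoc, e; reflexivity.
- exact (Hp I HI A P pr HP HA).
Qed.

Lemma closed_under_finite_limits_of_products_subobjects :
  has_finite_limits C ->
  closed_under_finite_products B -> closed_under_subobjects B ->
  closed_under_finite_limits B.
Proof.
intros HC Hp Hs J HJ D c Hc HD.
apply (closed_under_jointly_monic (l := leg c) HC Hp Hs (proj1 HJ)); [|exact HD].
intros t u v; apply (limit_ext Hc).
Qed.

Lemma closed_under_pullbacks (A X Y : C) (p : hom A Y) (f : hom X Y)
    (q : pullback p f) :
  has_finite_limits C ->
  closed_under_finite_products B -> closed_under_subobjects B ->
  B A -> B X -> B (pb_ob q).
Proof.
intros HC Hp Hs HA HX.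
apply (@closed_under_jointly_monic bool (fun i => if i then A else X) (pb_ob q)
  (fun i => match i return hom (pb_ob q) (if i then A else X) with
            | true => pb_fst q | false => pb_snd q end) HC Hp Hs).
- exists (true :: false :: nil); intros []; simpl; tauto.
- intros t u v e; apply (pb_ext q); [exact (e true)|exact (e false)].
- intros []; assumption.
Qed.

End Products.

(** * Points versus underlying objects *)

Section PointsFacts.

Variables (C : category) (Y : C).

(** The kernel pair of a morphism of points is again a point, and its two
    projections are morphisms of points. *)
Lemma point_mono_underlying (a b : Pt Y) (m : hom a b) :
  has_finite_limits C -> is_mono m -> is_mono (pt_mor m).
Proof.
intros HC Hm t u v e.
destruct (pullback_inhabited (pt_mor m) (pt_mor m) HC) as [K].
assert (es : pt_mor m ∘ pt_sect a = pt_mor m ∘ pt_sect a) by reflexivity.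
unshelve epose (k := @Point C Y (pb_ob K) (pt_proj a ∘ pb_fst K) (pb_pair K es) _).
{ rewrite <- comp_assoc, pb_pair_fst; apply pt_split. }
unshelve epose (k1 := @PointHom C Y k a (pb_fst K) _ _);
  [reflexivity|apply pb_pair_fst|].
unshelve epose (k2 := @PointHom C Y k a (pb_snd K) _ _).
{ simpl; rewrite <- (pt_mor_proj m), <- !comp_assoc, pb_comm; reflexivity. }
{ apply pb_pair_snd. }
assert (ek : k1 = k2).
{ apply (Hm k); apply point_hom_eq; simpl; apply pb_comm. }
apply (f_equal (fun h => pt_mor h)) in ek; simpl in ek.
rewrite <- (pb_pair_fst K e), ek; apply pb_pair_snd.
Qed.

Lemma point_iso_of_underlying (a b : Pt Y) (m : hom a b) :
  is_iso (pt_mor m) -> is_iso m.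
Proof.
intros [n [n1 n2]].
unshelve epose (n' := @PointHom C Y b a n _ _).
{ rewrite <- (pt_mor_proj m), <- comp_assoc, n2; apply comp_id_r. }
{ rewrite <- (pt_mor_sect m), comp_assoc, n1; apply comp_id_l. }
exists n'; split; apply point_hom_eq; assumption.
Qed.

Lemma point_jointly_strongly_epi (a b c : Pt Y) (f : hom a c) (g : hom b c) :
  has_finite_limits C ->
  jointly_strongly_epi (pt_mor f) (pt_mor g) -> jointly_strongly_epi f g.
Proof.
intros HC H s m Hm [f' ef] [g' eg].
apply point_iso_of_underlying, H.
- apply point_mono_underlying; assumption.
- exists (pt_mor f'); rewrite <- ef; reflexivity.
- exists (pt_mor g'); rewrite <- eg; reflexivity.
Qed.

(** A subobject of [c] through which [f] factors contains the section of [c],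
    since [f] maps the section of [a] to it; so it is a subobject of points. *)
Lemma underlying_jointly_strongly_epi (a b c : Pt Y) (f : hom a c) (g : hom b c) :
  jointly_strongly_epi f g -> jointly_strongly_epi (pt_mor f) (pt_mor g).
Proof.
intros H s m Hm [f' ef] [g' eg].
assert (es : m ∘ (f' ∘ pt_sect a) = pt_sect c).
{ rewrite comp_assoc, ef; apply pt_mor_sect. }
unshelve epose (s' := @Point C Y s (pt_proj c ∘ m) (f' ∘ pt_sect a) _).
{ rewrite <- comp_assoc, es; apply pt_split. }
unshelve epose (m' := @PointHom C Y s' c m _ _); [reflexivity|exact es|].
unshelve epose (f1 := @PointHom C Y a s' f' _ _).
{ simpl; rewrite <- comp_assoc, ef; apply pt_mor_proj. }
{ reflexivity. }
unshelve epose (g1 := @PointHom C Y b s' g' _ _).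
{ simpl; rewrite <- comp_assoc, eg; apply pt_mor_proj. }
{ apply Hm; simpl; rewrite es, comp_assoc, eg; apply pt_mor_sect. }
destruct (H s' m') as [n [n1 n2]].
- intros t u v e; apply point_hom_eq, Hm; exact (f_equal (fun h => pt_mor h) e).
- exists f1; apply point_hom_eq; exact ef.
- exists g1; apply point_hom_eq; exact eg.
- exists (pt_mor n); split.
  + exact (f_equal (fun h => pt_mor h) n1).
  + exact (f_equal (fun h => pt_mor h) n2).
Qed.

End PointsFacts.

(** * Change of base preserves finite limits *)

Section LimitsOfPoints.

(** A diagram of points over [Y] yields a diagram of this shape in [C], with [Y]
    at the new object and the projections as the new arrows; its limit is the
    limit over [Y] of the underlying diagram. *)
Definition adjoin_terminal (J : category) : category.
Proof.
refine (@Category (option J)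
  (fun i j => match i, j with
     | Some i, Some j => hom i j
     | _, None => unit
     | None, Some _ => Empty_set
     end)
  (fun i => match i with Some i => idm i | None => tt end)
  (fun i j k => match i, j, k with
     | Some i, Some j, Some k => fun g f => g ∘ f
     | _, _, None => fun _ _ => tt
     | None, Some _, Some _ => fun _ f => match f with end
     | _, None, Some _ => fun g _ => match g with end
     end) _ _ _).
- intros [i|] [j|] f; try destruct f; try reflexivity; apply comp_id_l.
- intros [i|] [j|] f; try destruct f; try reflexivity; apply comp_id_r.
- intros [i|] [j|] [k|] [l|] h g f;
    try (apply comp_assoc); try reflexivity; try destruct h; try destruct g;
    try destruct f; reflexivity.
Defined.

Lemma adjoin_terminal_finite (J : category) :
  finite_category J -> finite_category (adjoin_terminal J).
Proof.
intros [[l Hl] HJ]; split.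
- exists (None :: map Some l); intros [j|]; simpl; [right; apply in_map, Hl|tauto].
- intros [i|] [j|]; simpl; [apply HJ| |exists nil; intros []|];
    exists (tt :: nil); intros []; simpl; tauto.
Qed.

Variables (C : category) (Y : C) (J : category) (D : functor J (Pt Y)).

Definition points_over_base_ob (i : adjoin_terminal J) : C :=
  match i with Some j => pt_ob (D j) | None => Y end.

Definition points_over_base : functor (adjoin_terminal J) C.
Proof.
refine (@Functor (adjoin_terminal J) C points_over_base_ob
  (fun i j => match i, j return @hom (adjoin_terminal J) i j ->
        hom (points_over_base_ob i) (points_over_base_ob j) with
     | Some i, Some j => fun a => pt_mor (fmap D a)
     | Some i, None => fun _ => pt_proj (D i)
     | None, None => fun _ => idm Y
     | None, Some _ => fun a => match a with end
     end) _ _).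
- intros [j|]; simpl; [rewrite fmap_id|]; reflexivity.
- intros [i|] [j|] [k|] g f; simpl; try destruct g; try destruct f.
  + rewrite fmap_comp; reflexivity.
  + symmetry; apply pt_mor_proj.
  + symmetry; apply comp_id_l.
  + symmetry; apply comp_id_l.
Defined.

Definition cone_over_base (t : C) (l : forall j, hom t (pt_ob (D j))) (q : hom t Y)
    (el : forall i j (a : hom i j), pt_mor (fmap D a) ∘ l i = l j)
    (eq : forall j, pt_proj (D j) ∘ l j = q) : cone points_over_base.
Proof.
refine (@Cone _ C points_over_base t
  (fun i => match i return hom t (points_over_base_ob i) with
            | Some j => l j | None => q end) _).
intros [i|] [j|] a; simpl; [apply el|apply eq|destruct a|apply comp_id_l].
Defined.

(** A finite limit of points has its universal property with respect to all
    objects over [Y], not only points.  The limit [L] of the diagram of underlying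
    objects over [Y] becomes a point, with the section induced by the sections of
    the [D j], and carries a cone of points.  Hence [apex c] is a retract of [L]
    over [Y], compatibly with the legs, and inherits existence and uniqueness of
    mediating maps from [L]. *)
Lemma limit_of_points_over_base (c : cone D) (t : C)
    (l : forall j, hom t (pt_ob (D j))) (q : hom t Y) :
  has_finite_limits C -> finite_category J -> is_limit c ->
  (forall i j (a : hom i j), pt_mor (fmap D a) ∘ l i = l j) ->
  (forall j, pt_proj (D j) ∘ l j = q) ->
  exists! h : hom t (pt_ob (apex c)),
    pt_proj (apex c) ∘ h = q /\ forall j, pt_mor (leg c j) ∘ h = l j.
Proof.
intros HC HJ Hc el eq.
destruct (HC _ (adjoin_terminal_finite HJ) points_over_base) as [L HL].
pose (lp := leg L None : hom (apex L) Y).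
pose (ll := fun j => leg L (Some j) : hom (apex L) (pt_ob (D j))).
assert (Lp : forall j, pt_proj (D j) ∘ ll j = lp)
  by (intros j; exact (@leg_compat _ _ _ L (Some j) None tt)).
assert (Ll : forall i j (a : hom i j), pt_mor (fmap D a) ∘ ll i = ll j)
  by (intros i j a; exact (@leg_compat _ _ _ L (Some i) (Some j) a)).
assert (Lext : forall (t : C) (u v : hom t (apex L)), lp ∘ u = lp ∘ v ->
    (forall j, ll j ∘ u = ll j ∘ v) -> u = v).
{ intros t' u v ep ej; apply (limit_ext HL); intros [j|]; [apply ej|apply ep]. }
assert (Lex : forall (t : C) (l : forall j, hom t (pt_ob (D j))) (q : hom t Y),
    (forall i j (a : hom i j), pt_mor (fmap D a) ∘ l i = l j) ->
    (forall j, pt_proj (D j) ∘ l j = q) ->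
    exists h : hom t (apex L), lp ∘ h = q /\ forall j, ll j ∘ h = l j).
{ intros t' l' q' el' eq'; destruct (HL (cone_over_base el' eq')) as [h [Hh _]].
  exists h; split; [exact (Hh None)|intros j; exact (Hh (Some j))]. }
destruct (Lex Y (fun j => pt_sect (D j)) (idm Y)) as (s & sp & sl).
{ intros i j a; apply pt_mor_sect. }
{ intros j; apply pt_split. }
pose (L' := @Point C Y (apex L) lp s sp).
unshelve epose (cL := @Cone J (Pt Y) D L' (fun j => @PointHom C Y L' (D j) (ll j) _ _) _).
{ apply Lp. }
{ apply sl. }
{ intros i j a; apply point_hom_eq; apply Ll. }
destruct (Hc cL) as [r [Hr _]].
pose (rm := pt_mor r : hom (apex L) (pt_ob (apex c))).
assert (Hr' : forall j, pt_mor (leg c j) ∘ rm = ll j)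
  by (intros j; exact (f_equal (fun h => pt_mor h) (Hr j))).
destruct (Lex (pt_ob (apex c)) (fun j => pt_mor (leg c j)) (pt_proj (apex c)))
  as (k & kp & kl).
{ intros i j a; exact (f_equal (fun h => pt_mor h) (leg_compat c a)). }
{ intros j; apply pt_mor_proj. }
unshelve epose (k' := @PointHom C Y (apex c) L' k _ _).
{ exact kp. }
{ apply Lext; simpl.
  - rewrite comp_assoc, kp, sp; apply pt_split.
  - intros j; rewrite comp_assoc, kl, sl; apply pt_mor_sect. }
assert (rk : rm ∘ k = idm _).
{ change (pt_mor (r ∘ k' : hom (apex c) (apex c)) = pt_mor (idm (apex c))).
  f_equal; apply (limit_ext Hc); intros j; apply point_hom_eq; simpl.
  change (pt_mor (leg c j) ∘ (rm ∘ k) = pt_mor (leg c j) ∘ idm _).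
  rewrite comp_assoc, Hr', kl, comp_id_r; reflexivity. }
destruct (Lex t l q el eq) as (h & hp & hl).
exists (rm ∘ h); split.
- split.
  + rewrite comp_assoc, (pt_mor_proj r : pt_proj (apex c) ∘ rm = lp); exact hp.
  + intros j; rewrite comp_assoc, Hr'; apply hl.
- intros h' [hp' hl'].
  replace h' with (rm ∘ (k ∘ h')) by (rewrite comp_assoc, rk; apply comp_id_l).
  f_equal; apply Lext.
  + rewrite comp_assoc, kp, hp, hp'; reflexivity.
  + intros j; rewrite comp_assoc, kl, hl, hl'; reflexivity.
Qed.

End LimitsOfPoints.

(** A morphism from a point [T] over [X] into [f^* a] is a morphism over [Y] from
    [T], which is in general no longer a point over [Y], into [a].  This is
    where the stronger universal property of the limit is needed. *)
Lemma change_of_base_preserves_finite_limits (C : category) (X Y : C) (f : hom X Y)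
    (pb : pullbacks_along f) :
  has_finite_limits C -> preserves_finite_limits (change_of_base pb).
Proof.
intros HC J HJ D c Hc c'.
set (q := pb _ (pt_proj (apex c))).
pose (T := apex c').
pose (l := fun j => (pb_fst (pb _ (pt_proj (D j))) ∘ pt_mor (leg c' j))
             : hom (pt_ob T) (pt_ob (D j))).
assert (ep : forall j, pt_proj (D j) ∘ l j = f ∘ pt_proj T).
{ intros j; unfold l; rewrite comp_assoc, pb_comm, <- comp_assoc; f_equal.
  exact (pt_mor_proj (leg c' j)). }
assert (el : forall i j (a : hom i j), pt_mor (fmap D a) ∘ l i = l j).
{ intros i j a.
  transitivity (pb_fst (pb _ (pt_proj (D j))) ∘ pt_mor (fmap (change_of_base pb) (fmap D a))
                ∘ pt_mor (leg c' i)).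
  - unfold l; rewrite comp_assoc; f_equal; symmetry; apply pb_pair_fst.
  - unfold l; rewrite <- comp_assoc; f_equal.
    exact (f_equal (fun h => pt_mor h) (leg_compat c' a)). }
destruct (limit_of_points_over_base HC HJ Hc el ep) as (h & [hp hl] & hu).
unshelve epose (k := @PointHom C X T (base_change_ob pb (apex c)) (pb_pair q hp) _ _).
{ apply pb_pair_snd. }
{ apply (pb_ext q); simpl.
  - rewrite comp_assoc, !pb_pair_fst.
    (* Compatibility of the mediating map with sections: both composites from [X]
       mediate the cone formed by the sections of the [D j] precomposed with [f]. *)
    destruct (@limit_of_points_over_base C Y J D c X
      (fun j => pt_sect (D j) ∘ f) f HC HJ Hc) as (w & _ & wu).
    + intros i j a; rewrite comp_assoc, pt_mor_sect; reflexivity.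
    + intros j; rewrite comp_assoc, pt_split; apply comp_id_l.
    + transitivity w; [symmetry|]; apply wu; split.
      * rewrite comp_assoc, hp, <- comp_assoc, pt_split; apply comp_id_r.
      * intros j; rewrite comp_assoc, hl; unfold l; rewrite <- comp_assoc.
        transitivity (pb_fst (pb _ (pt_proj (D j)))
                      ∘ pt_sect (base_change_ob pb (D j))).
        { f_equal; exact (pt_mor_sect (leg c' j)). }
        apply pb_pair_fst.
      * rewrite comp_assoc, pt_split; apply comp_id_l.
      * intros j; rewrite comp_assoc, pt_mor_sect; reflexivity.
  - rewrite comp_assoc, !pb_pair_snd; apply pt_split. }
exists k; split.
- intros j; apply point_hom_eq; simpl; apply pb_ext.
  + rewrite comp_assoc, pb_pair_fst, <- comp_assoc, pb_pair_fst; apply hl.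
  + rewrite comp_assoc, !pb_pair_snd; symmetry; exact (pt_mor_proj (leg c' j)).
- intros k0 Hk0; apply point_hom_eq; simpl; apply (pb_ext q).
  + rewrite pb_pair_fst; apply hu; split.
    * rewrite comp_assoc, pb_comm, <- comp_assoc; f_equal; exact (pt_mor_proj k0).
    * intros j; unfold l; rewrite <- (Hk0 j); simpl.
      rewrite !comp_assoc, pb_pair_fst; reflexivity.
  + rewrite pb_pair_snd; symmetry; exact (pt_mor_proj k0).
Qed.

(** Algebraic coherence in terms of underlying morphisms and arbitrary pullback
    squares.  Freedom in the choice of squares allows them to be computed in a
    subcategory. *)
Lemma pullback_jointly_strongly_epi (C : category) (X Y : C) (f : hom X Y)
    (a b c : Pt Y) (u : hom a c) (v : hom b c)
    (a' b' c' : C) (a1 : hom a' (pt_ob a)) (a2 : hom a' X)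
    (b1 : hom b' (pt_ob b)) (b2 : hom b' X)
    (c1 : hom c' (pt_ob c)) (c2 : hom c' X) (u' : hom a' c') (v' : hom b' c') :
  algebraically_coherent C ->
  is_pullback (pt_proj a) f a1 a2 -> is_pullback (pt_proj b) f b1 b2 ->
  is_pullback (pt_proj c) f c1 c2 ->
  c1 ∘ u' = pt_mor u ∘ a1 -> c2 ∘ u' = a2 ->
  c1 ∘ v' = pt_mor v ∘ b1 -> c2 ∘ v' = b2 ->
  jointly_strongly_epi (pt_mor u) (pt_mor v) -> jointly_strongly_epi u' v'.
Proof.
intros [HC Hcoh] Ha Hb Hc u1 u2 v1 v2 H.
destruct (pullbacks_along_inhabited f HC) as [pb].
apply (point_jointly_strongly_epi HC) in H.
apply (proj2 (Hcoh X Y f pb)), underlying_jointly_strongly_epi in H.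
destruct (is_pullback_unique (pullback_is_pullback (pb _ (pt_proj a))) Ha)
  as (ka & _ & ka1 & ka2).
destruct (is_pullback_unique (pullback_is_pullback (pb _ (pt_proj b))) Hb)
  as (kb & _ & kb1 & kb2).
destruct (is_pullback_unique (pullback_is_pullback (pb _ (pt_proj c))) Hc)
  as (kc & kiso & kc1 & kc2).
refine (jointly_strongly_epi_transfer (a := ka) (b := kb) kiso _ _ H);
  apply (is_pullback_ext Hc); simpl.
- rewrite !comp_assoc, u1, kc1, <- comp_assoc, ka1, pb_pair_fst; reflexivity.
- rewrite !comp_assoc, u2, kc2, ka2, pb_pair_snd; reflexivity.
- rewrite !comp_assoc, v1, kc1, <- comp_assoc, kb1, pb_pair_fst; reflexivity.
- rewrite !comp_assoc, v2, kc2, kb2, pb_pair_snd; reflexivity.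
Qed.

(** * Full subcategories with well-behaved replete closure *)

Definition replete_closure (C : category) (B : C -> Prop) (x : C) : Prop :=
  exists (b : C) (i : hom x b), B b /\ is_iso i.

Lemma replete_closure_incl (C : category) (B : C -> Prop) (x : C) :
  B x -> replete_closure B x.
Proof. intros Hx; exists x, (idm x); split; [exact Hx|apply is_iso_id]. Qed.

Section Subcategory.

Variables (C : category) (B : C -> Prop).

Hypothesis C_coherent : algebraically_coherent C.
Hypothesis closure_products : closed_under_finite_products (replete_closure B).
Hypothesis closure_subobjects : closed_under_subobjects (replete_closure B).

Let Bc : category := full_subcategory B.

Lemma full_subcategory_has_finite_limits : has_finite_limits Bc.
Proof.
intros J HJ D.
pose (D' := functor_comp (inclusion B) D).
destruct (proj1 C_coherent J HJ D') as [c Hc].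
destruct (closed_under_finite_limits_of_products_subobjects (proj1 C_coherent)
  closure_products closure_subobjects HJ Hc) as (b & i & Hb & i' & i1 & i2).
{ intros j; apply replete_closure_incl; exact (proj2_sig (D j)). }
pose (b' := exist B b Hb : Bc).
unshelve epose (cB := @Cone J Bc D b' (fun j => @comp C _ _ _ (leg c j) i') _).
{ intros j k a; change (fmap D' a ∘ (leg c j ∘ i') = leg c k ∘ i').
  rewrite comp_assoc, leg_compat; reflexivity. }
exists cB; intros c'.
destruct (Hc (map_cone (inclusion B) c')) as [h [Hh hu]].
exists (@comp C _ _ _ i h); split.
- intros j; change (leg c j ∘ i' ∘ (i ∘ h) = leg (map_cone (inclusion B) c') j).
  rewrite <- comp_assoc, (comp_assoc i'), i1, comp_id_l; apply Hh.
- intros k Hk; change (i ∘ h = (k : @hom C _ _)).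
  rewrite (hu (@comp C _ _ _ i' k)).
  + rewrite comp_assoc, i2; apply comp_id_l.
  + intros j; rewrite comp_assoc; exact (Hk j).
Qed.

Lemma full_subcategory_pullback (A X Y : Bc) (p : hom A Y) (f : hom X Y) :
  exists (P : Bc) (u : hom P A) (v : hom P X),
    @is_pullback C (proj1_sig A) (proj1_sig X) (proj1_sig Y) (proj1_sig P) p f u v.
Proof.
destruct (@pullback_inhabited C _ _ _ p f (proj1 C_coherent)) as [q].
destruct (closed_under_pullbacks q (proj1 C_coherent) closure_products
  closure_subobjects) as (b & i & Hb & i' & i1 & i2).
{ apply replete_closure_incl; exact (proj2_sig A). }
{ apply replete_closure_incl; exact (proj2_sig X). }
exists (exist B b Hb), (@comp C _ _ _ (pb_fst q) i'), (@comp C _ _ _ (pb_snd q) i').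
split.
- rewrite !comp_assoc, pb_comm; reflexivity.
- intros t a x e; exists (@comp C _ _ _ i (pb_pair q e)); split.
  + split; rewrite <- comp_assoc, (comp_assoc i'), i1, comp_id_l;
      [apply pb_pair_fst|apply pb_pair_snd].
  + intros w [wa wx].
    replace w with (@comp C _ _ _ i (@comp C _ _ _ i' w))
      by (rewrite comp_assoc, i2; apply comp_id_l).
    f_equal; apply (pb_ext q).
    * rewrite pb_pair_fst, comp_assoc; symmetry; exact wa.
    * rewrite pb_pair_snd, comp_assoc; symmetry; exact wx.
Qed.

(** Some square that is a pullback in [C] has its vertex in [B], hence is also a
    pullback in [B], where it is isomorphic to any other. *)
Lemma inclusion_preserves_pullbacks (A X Y P : Bc) (p : hom A Y) (f : hom X Y)
    (u : hom P A) (v : hom P X) :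
  is_pullback p f u v ->
  @is_pullback C (proj1_sig A) (proj1_sig X) (proj1_sig Y) (proj1_sig P) p f u v.
Proof.
intros HP.
destruct (full_subcategory_pullback p f) as (Q & u' & v' & HQ).
assert (HQB : is_pullback (C := Bc) p f u' v').
{ split; [exact (proj1 HQ)|intros t; exact (proj2 HQ (proj1_sig t))]. }
assert (E : exists (k : @hom C (proj1_sig P) (proj1_sig Q))
    (k' : @hom C (proj1_sig Q) (proj1_sig P)),
    k' ∘ k = idm _ /\ k ∘ k' = idm _ /\
    @comp C _ _ (proj1_sig A) u' k = u /\ @comp C _ _ (proj1_sig X) v' k = v).
{ destruct (is_pullback_unique HP HQB) as (k & [k' [k1 k2]] & ku & kv).
  exists k, k'; repeat split; assumption. }
destruct E as (k & k' & k1 & k2 & ku & kv).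
split; [exact (proj1 HP)|]; intros t a x e.
destruct (proj2 HQ t a x e) as (w & [wa wx] & wu).
exists (@comp C _ _ _ k' w); split.
- split.
  + rewrite <- ku, <- comp_assoc, (comp_assoc k), k2, comp_id_l; exact wa.
  + rewrite <- kv, <- comp_assoc, (comp_assoc k), k2, comp_id_l; exact wx.
- intros w' [wa' wx']; rewrite (wu (@comp C _ _ _ k w')).
  + rewrite comp_assoc, k1; apply comp_id_l.
  + split; rewrite comp_assoc, ?ku, ?kv; assumption.
Qed.

(** Two maps out of an object [t] of [C] that [m] identifies factor through the
    kernel pair of [m], which lies in [B]; there [m] can be cancelled. *)
Lemma inclusion_preserves_mono (s z : Bc) (m : hom s z) :
  is_mono m -> @is_mono C (proj1_sig s) (proj1_sig z) m.
Proof.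
intros Hm t a x e.
destruct (full_subcategory_pullback m m) as (K & u & v & HK).
destruct (proj2 HK t a x e) as (w & [wa wx] & _).
assert (uv : u = v) by exact (Hm K u v (proj1 HK)).
rewrite <- wa, <- wx, uv; reflexivity.
Qed.

(** From [B] to [C], subobjects in [C] are replaced by isomorphic ones in [B];
    from [C] to [B], monomorphisms of [B] are monomorphisms of [C]. *)
Lemma inclusion_jointly_strongly_epi (x y z : Bc) (f : hom x z) (g : hom y z) :
  jointly_strongly_epi f g <->
  @jointly_strongly_epi C (proj1_sig x) (proj1_sig y) (proj1_sig z) f g.
Proof.
split.
- intros H s m Hm [f' ef] [g' eg].
  destruct (closure_subobjects Hm (replete_closure_incl (proj2_sig z)))
    as (b & i & Hb & i' & i1 & i2).
  assert (Hi' : is_iso i') by (exists i; split; assumption).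
  pose (m' := (@comp C _ _ _ m i') : @hom Bc (exist B b Hb) z).
  assert (Hm' : is_iso (C := Bc) m').
  { apply H.
    - intros t; exact (is_mono_comp Hm (is_iso_mono Hi') (t := proj1_sig t)).
    - exists (@comp C _ _ _ i f').
      change (m ∘ i' ∘ (i ∘ f') = f).
      rewrite <- comp_assoc, (comp_assoc i'), i1, comp_id_l; exact ef.
    - exists (@comp C _ _ _ i g').
      change (m ∘ i' ∘ (i ∘ g') = g).
      rewrite <- comp_assoc, (comp_assoc i'), i1, comp_id_l; exact eg. }
  exact (is_iso_of_comp_r Hi' Hm').
- intros H s m Hm Hf Hg.
  exact (H (proj1_sig s) m (inclusion_preserves_mono Hm) Hf Hg).
Qed.

Definition point_inclusion (Y : Bc) (a : point Y) : @point C (proj1_sig Y) :=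
  @Point C (proj1_sig Y) (proj1_sig (pt_ob a)) (pt_proj a) (pt_sect a) (pt_split a).

Definition point_hom_inclusion (Y : Bc) (a b : point Y) (h : point_hom a b) :
    point_hom (point_inclusion a) (point_inclusion b) :=
  @PointHom C (proj1_sig Y) (point_inclusion a) (point_inclusion b)
    (pt_mor h) (pt_mor_proj h) (pt_mor_sect h).

Lemma full_subcategory_algebraically_coherent : algebraically_coherent Bc.
Proof.
pose proof full_subcategory_has_finite_limits as HB.
split; [exact HB|]; intros X Y f pb.
split; [apply change_of_base_preserves_finite_limits; exact HB|].
intros a b c u v H.
apply (point_jointly_strongly_epi HB), inclusion_jointly_strongly_epi.
apply underlying_jointly_strongly_epi, inclusion_jointly_strongly_epi in H.
apply (@pullback_jointly_strongly_epi C (proj1_sig X) (proj1_sig Y) f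
  (point_inclusion a) (point_inclusion b) (point_inclusion c)
  (point_hom_inclusion u) (point_hom_inclusion v) _ _ _
  (pb_fst (pb _ (pt_proj a))) (pb_snd (pb _ (pt_proj a)))
  (pb_fst (pb _ (pt_proj b))) (pb_snd (pb _ (pt_proj b)))
  (pb_fst (pb _ (pt_proj c))) (pb_snd (pb _ (pt_proj c))) _ _ C_coherent).
- exact (inclusion_preserves_pullbacks (pullback_is_pullback (pb _ (pt_proj a)))).
- exact (inclusion_preserves_pullbacks (pullback_is_pullback (pb _ (pt_proj b)))).
- exact (inclusion_preserves_pullbacks (pullback_is_pullback (pb _ (pt_proj c)))).
- exact (pb_pair_fst (pb _ (pt_proj c)) (base_change_hom_comm pb u)).
- exact (pb_pair_snd (pb _ (pt_proj c)) (base_change_hom_comm pb u)).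
- exact (pb_pair_fst (pb _ (pt_proj c)) (base_change_hom_comm pb v)).
- exact (pb_pair_snd (pb _ (pt_proj c)) (base_change_hom_comm pb v)).
- exact H.
Qed.

End Subcategory.

(** * Regular-epi-reflective subcategories *)

Section Reflective.

Variables (C : category) (B : C -> Prop) (R : functor C (full_subcategory B)).
Variable adj : adjunction R (inclusion B).
Hypothesis unit_regular_epi : forall x, is_regular_epi (adj_unit adj x).

(** A retraction makes the unit monic, and a monic regular epimorphism is
    invertible. *)
Lemma unit_iso_of_retraction (x : C) (r : hom (inclusion B (R x)) x) :
  r ∘ adj_unit adj x = idm x -> is_iso (adj_unit adj x).
Proof.
intros e; apply (regular_epi_mono_iso (unit_regular_epi x)).
apply (@is_mono_of_comp C _ _ _ r); rewrite e; apply is_iso_mono, is_iso_id.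
Qed.

(** At an object of [B] a triangle identity splits the unit by the counit, and
    naturality carries this along the isomorphism [i]. *)
Lemma replete_closure_reflective (x : C) :
  replete_closure B x <-> is_iso (adj_unit adj x).
Proof.
split.
- intros (b & i & Hb & i' & i1 & i2).
  pose (b' := exist B b Hb : full_subcategory B).
  change (hom x (inclusion B b')) in i.
  change (hom (inclusion B b') x) in i'.
  apply (@unit_iso_of_retraction x
    (i' ∘ fmap (inclusion B) (adj_counit adj b') ∘ fmap (inclusion B) (fmap R i))).
  rewrite <- comp_assoc, <- (adj_unit_natural adj i), <- (comp_assoc i').
  rewrite (comp_assoc (fmap (inclusion B) (adj_counit adj b'))).
  rewrite (adj_triangle_r adj b'), comp_id_l; exact i1.
- intros H; exists (proj1_sig (R x)), (adj_unit adj x).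
  split; [exact (proj2_sig (R x))|exact H].
Qed.

(** The projections of the product [P] extend along the unit at [P], because the
    units at the factors are invertible; together the extensions form a retraction
    of the unit. *)
Lemma reflective_closure_products : closed_under_finite_products (replete_closure B).
Proof.
intros I HI A P pr HP HA; apply replete_closure_reflective.
assert (H : forall i, exists r : hom (inclusion B (R P)) (A i),
    r ∘ adj_unit adj P = pr i).
{ intros i; destruct (proj1 (replete_closure_reflective (A i)) (HA i)) as [n [n1 _]].
  exists (n ∘ fmap (inclusion B) (fmap R (pr i))).
  rewrite <- comp_assoc, <- (adj_unit_natural adj), comp_assoc, n1; apply comp_id_l. }
pose (r := fun i => proj1_sig (constructive_indefinite_description _ (H i))).
assert (Hr : forall i, r i ∘ adj_unit adj P = pr i)
  by (intros i; exact (proj2_sig (constructive_indefinite_description _ (H i)))).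
destruct (HP _ r) as [h [Hh _]].
apply (@unit_iso_of_retraction P h).
destruct (HP P pr) as [w [_ wu]].
transitivity w; [symmetry|]; apply wu; intros i.
- rewrite comp_assoc, Hh; apply Hr.
- apply comp_id_r.
Qed.

(** By naturality the unit at [s] is a first factor of the monomorphism
    obtained from [m] and the invertible unit at [x]. *)
Lemma reflective_closure_subobjects : closed_under_subobjects (replete_closure B).
Proof.
intros s x m Hm Hx; apply replete_closure_reflective in Hx.
apply replete_closure_reflective, (regular_epi_mono_iso (unit_regular_epi s)).
apply (@is_mono_of_comp C _ _ _ (fmap (inclusion B) (fmap R m))).
rewrite <- (adj_unit_natural adj).
exact (is_mono_comp (is_iso_mono Hx) Hm).
Qed.

End Reflective.

(** * Algebraic coherence of full subcategories *)

Theorem proposition3p7 (C : category) (B : ob C -> Prop)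
    (C_coherent : algebraically_coherent C) :
  (closed_under_finite_products B -> closed_under_subobjects B ->
     closed_under_finite_limits B /\ algebraically_coherent (full_subcategory B)) /\
  (regular_epi_reflective B -> algebraically_coherent (full_subcategory B)).
Proof.
split.
- intros Hp Hs.
  assert (HB : forall x, replete_closure B x -> B x).
  { intros x (b & i & Hb & Hi); exact (Hs x b i (is_iso_mono Hi) Hb). }
  split.
  + exact (closed_under_finite_limits_of_products_subobjects (proj1 C_coherent) Hp Hs).
  + apply (full_subcategory_algebraically_coherent C_coherent).
    * intros I HI A P pr HP HA; apply replete_closure_incl, (Hp I HI A P pr HP).
      intros i; apply HB, HA.
    * intros s x m Hm Hx; apply replete_closure_incl, (Hs s x m Hm), HB, Hx.
- intros (R & adj & Hreg).
  apply (full_subcategory_algebraically_coherent C_coherent).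
  + exact (reflective_closure_products Hreg).
  + exact (reflective_closure_subobjects Hreg).
Qed.
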